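(* For all positive integers $m,n$, \[\mathcal{I}_m(n)=m\,3^{n-1}-2\sum_{s=1}^{n-1}3^{n-s-1}\mathcal{D}(s,1),\] where $\mathcal{D}(s,1)$ is computed in the table with $m$ rows.
   Context: For positive integers $m,n$, $T_{m,n}$ is the table with $m$ rows and $n$ columns, with steps $(1,0),(1,1),(1,-1)$ (move one column right and stay, go up one row, or go down one row). $\mathcal{I}_m(n)$ is the number of sequences $(r_1,\dots,r_n)$ with $r_i\in\{1,\dots,m\}$ and $|r_{i+1}-r_i|\le1$ (perfect lattice paths from the first to the last column staying in the table). For $s\ge1$ and $1\le t\le m$, $\mathcal{D}(s,t)$ is the number of sequences $(r_1,\dots,r_s)$ with $r_i\in\{1,\dots,m\}$, $|r_{i+1}-r_i|\le1$, and $r_s=t$, i.e. the number of such paths in the $m$-row table from any cell of the first column to the cell in column $s$, row $t$. *)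

(* Defs.v *)
From mathcomp Require Import all_boot all_order all_algebra.

Set Implicit Arguments.
Unset Strict Implicit.
Unset Printing Implicit Defensive.

Import IntDist.

(* Row k of the table, 1 <= k <= m, is the ordinal of value k - 1 in 'I_m. *)
Definition row_step (m : nat) : rel 'I_m := fun a b => `|a - b|%N <= 1.

Definition perfect_path (m n : nat) (r : n.-tuple 'I_m) : bool :=
  sorted (@row_step m) r.

Definition paths_count (m n : nat) : nat :=
  #|[set r : n.-tuple 'I_m | perfect_path r]|.

Definition row_numbers (m n : nat) (r : n.-tuple 'I_m) : seq nat :=
  [seq (val i).+1 | i <- r].

(* The row t is numbered from 1; the default 0 of last is not a row number. *)
Definition paths_to_count (m s t : nat) : nat :=
  #|[set r : s.-tuple 'I_m | perfect_path r & last 0 (row_numbers r) == t]|.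

(* Main.v *)
(** A path ending in row t extends by one column in 3 ways, except that one way
    is lost if t is the bottom row and one if t is the top row (both, when
    m = 1).  Reflecting the table exchanges these rows, so as many paths end at
    the top as at the bottom.  Hence I(n+1) = 3 I(n) - 2 D(n,1), and the formula
    is the solution of this recurrence with I(1) = m. *)
Require Import Defs.
From mathcomp Require Import all_boot all_order all_algebra.
From mathcomp Require Import zify ring.

Import GRing.Theory Num.Theory.
Local Open Scope ring_scope.

(** The three terms stand for the neighbours [a - 1], [a] and [a + 1]. Leaving [a] unbounded by [m]
    lets the induction on [m] go through. *)
Lemma card_row_step_ord (a m : nat) :
  (\sum_(b < m) (`|a - b| <= 1) = (0 < a <= m) + (a < m) + (a.+1 < m))%N.
Proof. by elim: m => [|m IHm]; rewrite ?big_ord0 ?big_ord_recr ?IHm /=; lia. Qed.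

Lemma card_row_step (m : nat) (a : 'I_m) :
  (\sum_(b < m) row_step a b + (a.+1 == 1) + (a.+1 == m) = 3)%N.
Proof. by rewrite card_row_step_ord; have := ltn_ord a; lia. Qed.

(** Serves to split off the last column of a path. *)
Lemma rcons_tuple_bij (T : finType) (n : nat) :
  bijective (fun p : n.-tuple T * T => [tuple of rcons p.1 p.2]).
Proof.
apply: inj_card_bij => [[r b] [r' b'] /(congr1 val) /= /rcons_inj[rr' ->]|].
  by congr pair; apply: val_inj.
by rewrite card_prod !card_tuple expnSr.
Qed.

(** The tuple is nonempty, so neither default, [0] or [ord0], is ever returned. *)
Lemma last_row_numbers (m n : nat) (r : n.+1.-tuple 'I_m.+1) :
  last 0%N (row_numbers r) = (last ord0 r).+1.
Proof.
by case/tupleP: r => x r; rewrite /row_numbers /= (last_map (fun i => (val i).+1)).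
Qed.

Lemma perfect_path_rcons (m n : nat) (r : n.+1.-tuple 'I_m.+1) (b : 'I_m.+1) :
  perfect_path [tuple of rcons r b] = perfect_path r && row_step (last ord0 r) b.
Proof. by case/tupleP: r => x r; rewrite /perfect_path /= rcons_path. Qed.

(** Reflection preserves distances between rows. *)
Lemma perfect_path_rev_ord (m n : nat) (r : n.-tuple 'I_m) :
  perfect_path (map_tuple (@rev_ord m) r) = perfect_path r.
Proof.
rewrite /perfect_path /= sorted_map; apply: eq_sorted => a b.
by rewrite /= /row_step /=; have := ltn_ord a; have := ltn_ord b; lia.
Qed.

Lemma paths_countE (m n : nat) :
  paths_count m n = (\sum_(r : n.-tuple 'I_m | perfect_path r) 1)%N.
Proof. by rewrite /paths_count -sum1_card; apply: eq_bigl => r; rewrite inE. Qed.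

(** Moving the end condition into the summand lets counts for different [t] be added path by
    path. *)
Lemma paths_to_countE (m n t : nat) :
  paths_to_count m.+1 n.+1 t =
  (\sum_(r : n.+1.-tuple 'I_m.+1 | perfect_path r) ((last ord0 r).+1 == t))%N.
Proof.
rewrite /paths_to_count -sum1_card big_mkcond [RHS]big_mkcond /=.
apply: eq_bigr => r _; rewrite inE last_row_numbers.
by case: perfect_path; case: eqP.
Qed.

Lemma paths_countS (m n : nat) :
  paths_count m.+1 n.+2 =
  (\sum_(r : n.+1.-tuple 'I_m.+1 | perfect_path r)
     \sum_(b < m.+1) row_step (last ord0 r) b)%N.
Proof.
rewrite paths_countE (reindex _ (onW_bij _ (rcons_tuple_bij _ _))) /=.
rewrite (eq_bigl _ _ (fun p => perfect_path_rcons _ _ p.1 p.2)).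
rewrite -(pair_big_dep (@perfect_path _ _)
            (fun r b => row_step (last ord0 r) b) (fun _ _ => 1%N)) /=.
by apply: eq_bigr => r _; rewrite big_mkcond; apply: eq_bigr => b _; case: row_step.
Qed.

Lemma paths_to_count_top (m n : nat) :
  paths_to_count m.+1 n.+1 m.+1 = paths_to_count m.+1 n.+1 1.
Proof.
have rev_inj : injective (fun r : n.+1.-tuple 'I_m.+1 => map_tuple (@rev_ord _) r).
  move=> r s /(congr1 val) /= /(inj_map rev_ord_inj) rs; exact: val_inj.
rewrite !paths_to_countE (reindex_inj rev_inj) /=.
rewrite (eq_bigl _ _ (@perfect_path_rev_ord _ _)).
apply: eq_bigr => r _; case/tupleP: r => x r /=.
by rewrite last_map /=; have := ltn_ord (last x r); lia.
Qed.

Lemma paths_count_rec (m n : nat) :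
  (paths_count m.+1 n.+2 + 2 * paths_to_count m.+1 n.+1 1 =
   3 * paths_count m.+1 n.+1)%N.
Proof.
(* One of the two copies of the bottom count becomes the top count; all three sums then range over
   the same paths, and [card_row_step] applies to each path. *)
rewrite mul2n -addnn -{2}paths_to_count_top !paths_to_countE paths_countS.
rewrite addnA -!big_split paths_countE big_distrr /=.
by apply: eq_bigr => r _; rewrite card_row_step.
Qed.

Lemma paths_count1 (m : nat) : paths_count m 1 = m.
Proof.
rewrite /paths_count -[RHS]card_ord -[RHS]expn1 -card_tuple -cardsT.
by apply: eq_card => r; rewrite !inE /perfect_path; case/tupleP: r => x r; rewrite tuple0.
Qed.

Theorem theorem2p4 (m n : nat) (m_gt0 : (0 < m)%N) (n_gt0 : (0 < n)%N) :
  (paths_count m n)%:Z =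
    m%:Z * 3 ^+ (n - 1)
    - 2 * \sum_(1 <= s < n) 3 ^+ (n - s - 1) * (paths_to_count m s 1)%:Z.
Proof.
case: m m_gt0 => // m _; case: n n_gt0 => // n _.
elim: n => [|n IHn]; first by rewrite paths_count1 big_geq //= mulr0 subr0 mulr1.
have -> : (paths_count m.+1 n.+2)%:Z =
    3 * (paths_count m.+1 n.+1)%:Z - 2 * (paths_to_count m.+1 n.+1 1)%:Z.
  by have := paths_count_rec m n; lia.
rewrite IHn [in RHS]big_nat_recr // subSnn subnn expr0 mul1r.
(* The term [s = n.+1] was split off with exponent 0. Each earlier term gains a factor 3; [s <= n]
   keeps the natural subtraction from truncating. *)
have -> : \sum_(1 <= s < n.+1)
      3 ^+ (n.+2 - s - 1) * (paths_to_count m.+1 s 1)%:Z =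
    3 * \sum_(1 <= s < n.+1)
      3 ^+ (n.+1 - s - 1) * (paths_to_count m.+1 s 1)%:Z :> int.
  rewrite mulr_sumr; apply: eq_big_nat => s /andP[_ s_le_n].
  by rewrite mulrA -exprS; congr (_ ^+ _ * _); lia.
by rewrite !subn1 /= exprS; ring.
Qed.
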